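(* Let $S$ be a finite $E$-solid semigroup. Then $S$ has a permutation matching if and only if, for each $a\in S$, the maximal (non-zero) rectangular subbands of the $0$-rectangular band $(D_a\cup\{0\})/\mathcal{H}$ are pairwise similar. Moreover, if $S$ has a permutation matching then $S$ has an involution matching.
   Context: For an element $a$ of a semigroup $S$, $V(a)=\{b\in S: aba=a,\ bab=b\}$ is its set of inverses; $S$ is regular if $V(a)\ne\emptyset$ for all $a$. $E(S)$ is the set of idempotents. $\mathcal{L},\mathcal{R},\mathcal{H},\mathcal{D}$ are Green's relations and $D_a$ is the $\mathcal{D}$-class of $a$. A permutation matching of $S$ is a permutation $f$ of the set $S$ with $f(a)\in V(a)$ for all $a\in S$; it is an involution matching if moreover $f^2$ is the identity map. A regular semigroup $S$ is $E$-solid if for all $e,f,g\in E(S)$ with $e\,\mathcal{L}\,f\,\mathcal{R}\,g$ there exists $h\in E(S)$ with $e\,\mathcal{R}\,h\,\mathcal{L}\,g$. For $S$ finite and regular, $D_a\cup\{0\}$ denotes the principal factor: a zero $0$ is adjoined to $D_a$, and for $x,y\in D_a$ the product $xy$ is as in $S$ if it lies in $D_a$ and is $0$ otherwise. This is a completely $0$-simple semigroup, on which $\mathcal{H}$ is a congruence; the quotient $(D_a\cup\{0\})/\mathcal{H}$ is a $0$-rectangular band, i.e. a completely $0$-simple semigroup with trivial $\mathcal{H}$-relation. A rectangular band is a semigroup satisfying $x^2=x$ and $xyx=x$. The maximal rectangular subbands of $B=(D_a\cup\{0\})/\mathcal{H}$ meant here are the subsemigroups of $B$ contained in $B\setminus\{0\}$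 that are rectangular bands and are maximal with respect to inclusion among these. Two finite rectangular bands $U_1,U_2$, where $U_i$ has $m_i$ $\mathcal{R}$-classes and $n_i$ $\mathcal{L}$-classes, are similar if $\frac{m_1}{n_1}=\frac{m_2}{n_2}$. *)

(* Defs.v *)
From HB Require Import structures.
From mathcomp Require Import all_boot.

(* Hierarchy-Builder accepts this join only before fingroup, which declares
   finStarMonoidType over Finite and Semigroup, is loaded. *)
#[short(type="finSemigroupType")]
HB.structure Definition FinSemigroup := {S of Semigroup S & Finite S}.

From mathcomp Require Import all_order all_algebra all_fingroup.

Set Implicit Arguments.
Unset Strict Implicit.
Unset Printing Implicit Defensive.

Import GRing.Theory.

Local Open Scope quotient_scope.
Local Open Scope group_scope.

Section Basics.
Variable S : finSemigroupType.
Implicit Types (a b c : S) (A U : {set S}).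

Definition inverses a : {set S} := [set b | (a * b * a == a) && (b * a * b == b)].

Definition idempotents : {set S} := [set e | e * e == e].

Definition regular_semigroup : Prop := forall a, inverses a != set0.

(* Green's relations of the subsemigroup A, to be applied to elements of A.
   The test a == b plays the role of the identity adjoined in A^1.
   The relations of S itself are those of [set: S]. *)
Definition leL A a b := (a == b) || [exists x in A, a == x * b].
Definition leR A a b := (a == b) || [exists x in A, a == b * x].
Definition greenL A a b := leL A a b && leL A b a.
Definition greenR A a b := leR A a b && leR A b a.
Definition greenH A a b := greenL A a b && greenR A a b.
Definition greenD A a b := [exists c in A, greenL A a c && greenR A c b].

Definition Dclass a : {set S} := [set b | greenD [set: S] a b].

Definition E_solid : Prop :=
  regular_semigroup /\
  forall e f g, e \in idempotents -> f \in idempotents -> g \in idempotents ->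
    greenL [set: S] e f -> greenR [set: S] f g ->
    exists h, [/\ h \in idempotents, greenR [set: S] e h & greenL [set: S] h g].

Definition permutation_matching (f : {perm S}) : Prop :=
  forall a, f a \in inverses a.

Definition involution_matching (f : {perm S}) : Prop :=
  permutation_matching f /\ forall a, f (f a) = a.

Definition subsemigroup U : bool :=
  (U != set0) && [forall x in U, forall y in U, x * y \in U].

Definition rectangular_subband U : bool :=
  [&& subsemigroup U, [forall x in U, x * x == x]
    & [forall x in U, forall y in U, x * y * x == x]].

(* The classes of U as a semigroup on its own, not as a subset of S. *)
Definition num_Rclasses U : nat := #|equivalence_partition (greenR U) U|.
Definition num_Lclasses U : nat := #|equivalence_partition (greenL U) U|.

Definition similar_bands U1 U2 : Prop :=
  ((num_Rclasses U1)%:R / (num_Lclasses U1)%:R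
   = (num_Rclasses U2)%:R / (num_Lclasses U2)%:R :> rat)%R.

End Basics.

Section GreenTheory.
Variable S : finSemigroupType.
Implicit Types a b c x y z : S.
Local Notation T := [set: S].

Lemma leLP a b : reflect (a = b \/ exists x, a = x * b) (leL T a b).
Proof.
apply: (iffP orP) => -[/eqP->|]; try by left.
  by case/exists_inP=> x _ /eqP ->; right; exists x.
by case=> x ->; right; apply/exists_inP; exists x; rewrite ?inE.
Qed.

Lemma leRP a b : reflect (a = b \/ exists x, a = b * x) (leR T a b).
Proof.
apply: (iffP orP) => -[/eqP->|]; try by left.
  by case/exists_inP=> x _ /eqP ->; right; exists x.
by case=> x ->; right; apply/exists_inP; exists x; rewrite ?inE.
Qed.

Lemma leL_refl a : leL T a a. Proof. by apply/leLP; left. Qed.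
Lemma leR_refl a : leR T a a. Proof. by apply/leRP; left. Qed.

Lemma leL_mul x a : leL T (x * a) a.
Proof. by apply/leLP; right; exists x. Qed.
Lemma leR_mul x a : leR T (a * x) a.
Proof. by apply/leRP; right; exists x. Qed.

Lemma leL_trans : transitive (leL T).
Proof.
move=> b a c /leLP[->//|[x ->]] /leLP[->|[y ->]]; first exact: leL_mul.
by rewrite mulgA leL_mul.
Qed.
Lemma leR_trans : transitive (leR T).
Proof.
move=> b a c /leRP[->//|[x ->]] /leRP[->|[y ->]]; first exact: leR_mul.
by rewrite -mulgA leR_mul.
Qed.

Lemma leL_mulr x a b : leL T a b -> leL T (a * x) (b * x).
Proof. by case/leLP=> [->|[y ->]]; rewrite ?leL_refl // -mulgA leL_mul. Qed.
Lemma leR_mull x a b : leR T a b -> leR T (x * a) (x * b).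
Proof. by case/leRP=> [->|[y ->]]; rewrite ?leR_refl // mulgA leR_mul. Qed.

Lemma greenL_refl : reflexive (greenL T).
Proof. by move=> a; rewrite /greenL leL_refl. Qed.
Lemma greenR_refl : reflexive (greenR T).
Proof. by move=> a; rewrite /greenR leR_refl. Qed.
Lemma greenL_sym : symmetric (greenL T).
Proof. by move=> a b; rewrite /greenL andbC. Qed.
Lemma greenR_sym : symmetric (greenR T).
Proof. by move=> a b; rewrite /greenR andbC. Qed.
Lemma greenL_trans : transitive (greenL T).
Proof.
move=> b a c /andP[ab ba] /andP[bc cb].
by rewrite /greenL (leL_trans ab bc) (leL_trans cb ba).
Qed.
Lemma greenR_trans : transitive (greenR T).
Proof.
move=> b a c /andP[ab ba] /andP[bc cb].
by rewrite /greenR (leR_trans ab bc) (leR_trans cb ba).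
Qed.

Lemma greenH_refl : reflexive (greenH T).
Proof. by move=> a; rewrite /greenH greenL_refl greenR_refl. Qed.
Lemma greenH_sym : symmetric (greenH T).
Proof. by move=> a b; rewrite /greenH greenL_sym greenR_sym. Qed.
Lemma greenH_trans : transitive (greenH T).
Proof.
move=> b a c /andP[Lab Rab] /andP[Lbc Rbc].
by rewrite /greenH (greenL_trans Lab Lbc) (greenR_trans Rab Rbc).
Qed.

Lemma greenRL_comm a b c :
  greenR T a b -> greenL T b c -> exists2 d, greenL T a d & greenR T d c.
Proof.
case/andP=> /leRP ab /leRP ba /andP[/leLP bc /leLP cb].
case: cb => [->|[u cE]]; first by exists a; rewrite ?greenL_refl //; apply/andP; split; apply/leRP.
case: ab => [->|[p aE]].
  exists c; rewrite ?greenR_refl //.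
  by apply/andP; split; apply/leLP => //; right; exists u.
exists (u * a).
  rewrite /greenL leL_mul andbT.
  case: bc => [bc|[v bE]]; apply/leLP; right.
    have ub : u * b = b by rewrite -cE bc.
    by exists u; rewrite aE !mulgA -(mulgA u u) !ub.
  by exists v; rewrite aE !mulgA -(mulgA v) -cE -bE.
rewrite /greenR; apply/andP; split; rewrite cE; apply: leR_mull; apply/leRP => //.
by right; exists p.
Qed.

Lemma greenD_R a b c : greenD T a b -> greenR T b c -> greenD T a c.
Proof.
case/exists_inP=> d Td /andP[ad db] bc; apply/exists_inP; exists d => //.
by rewrite ad (greenR_trans db bc).
Qed.

Lemma greenD_L a b c : greenD T a b -> greenL T b c -> greenD T a c.
Proof.
case/exists_inP=> d Td /andP[ad db] bc.
have [e de ec] := greenRL_comm db bc.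
by apply/exists_inP; exists e; rewrite ?inE // (greenL_trans ad de).
Qed.

Lemma iter_eq_lt (f : S -> S) a :
  exists i k, iter i f a = iter (i + k.+1) f a.
Proof.
have: ~~ injectiveb (fun i : 'I_#|S|.+1 => iter i f a).
  apply/negP => /injectiveP inj.
  by have := leq_card _ inj; rewrite card_ord ltnn.
case/injectivePn => i [j nij eij].
wlog lij : i j nij eij / i < j.
  move=> wl; case: (ltngtP i j) => [|ji|/val_inj e]; first exact: wl.
    by apply: (wl j i); rewrite // eq_sym.
  by rewrite e eqxx in nij.
by exists i, (j - i).-1; rewrite prednK ?subn_gt0 // subnKC // ltnW.
Qed.

Lemma iter_mul_cancel (f g : S -> S) a :
    (forall x, f (g x) = g (f x)) -> f (g a) = a ->
  exists k, iter k.+1 g a = a.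
Proof.
move=> fg fga.
have canc i : iter i f (iter i g a) = a.
  elim: i => //= i IHi.
  have -> : f (iter i f (g (iter i g a))) = iter i f (f (g (iter i g a))).
    by rewrite -iterS iterSr.
  suff -> : f (g (iter i g a)) = iter i g a by [].
  by elim: i {IHi} => //= i IHi; rewrite fg IHi.
have [i [k e]] := iter_eq_lt g a.
exists k; rewrite -[RHS](canc i) e addnC iterD.
set m := k.+1; rewrite -[LHS]/(iter m g a).
have comm n x : iter n f (g x) = g (iter n f x).
  by elim: n => //= n ->; rewrite fg.
have comm2 n m' x : iter n f (iter m' g x) = iter m' g (iter n f x).
  by elim: m' => //= m' IH; rewrite comm IH.
by rewrite comm2 canc.
Qed.

Definition lact (u : option S) x := if u is Some v then v * x else x.
Definition ract (u : option S) x := if u is Some v then x * v else x.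

Lemma leL_lact a b : leL T a b -> exists u, a = lact u b.
Proof. by case/leLP=> [->|[x ->]]; [exists None | exists (Some x)]. Qed.
Lemma leR_ract a b : leR T a b -> exists u, a = ract u b.
Proof. by case/leRP=> [->|[x ->]]; [exists None | exists (Some x)]. Qed.

(* Stability of finite semigroups: it makes the product of principal_factor
   associative, and H a congruence there. *)
Lemma stableR x y : greenD T (x * y) x -> greenR T x (x * y).
Proof.
case/exists_inP=> c _ /andP[/andP[_ Lc] /andP[_ Rx]].
have [u cE] := leL_lact Lc; have [w xE] := leR_ract Rx.
rewrite /greenR leR_mul andbT.
have [||k kE] := @iter_mul_cancel (lact u) (fun s => ract w (s * y)) x.
- by move=> s; case: (u) => [u'|]; case: (w) => [w'|] //=; rewrite !mulgA.
- rewrite {2}xE cE; case: (u) => [u'|]; case: (w) => [w'|] //=;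
  by rewrite !mulgA.
have gR s : leR T (ract w (s * y)) s.
  by case: (w) => [w'|] /=; rewrite -?mulgA leR_mul.
rewrite -{1}kE; elim: k {kE} => [|k IHk] /=.
  by case: (w) => [w'|] /=; rewrite ?leR_mul ?leR_refl.
exact: leR_trans (gR _) IHk.
Qed.

Lemma greenD_sym : symmetric (greenD T).
Proof.
suff sub a b : greenD T a b -> greenD T b a by move=> a b; apply/idP/idP; apply: sub.
case/exists_inP=> c _ /andP[ac cb].
have [||d bd da] := @greenRL_comm b c a; rewrite 1?greenR_sym 1?greenL_sym //.
by apply/exists_inP; exists d; rewrite ?inE // bd.
Qed.

Lemma greenD_refl : reflexive (greenD T).
Proof.
by move=> a; apply/exists_inP; exists a; rewrite ?inE // greenL_refl greenR_refl.
Qed.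

Lemma greenD_trans : transitive (greenD T).
Proof.
move=> b a c ab /exists_inP[d _ /andP[bd dc]].
exact: greenD_R (greenD_L ab bd) dc.
Qed.

Lemma stableL x y : greenD T (y * x) x -> greenL T x (y * x).
Proof.
rewrite greenD_sym => /exists_inP[c _ /andP[/andP[Lx _] /andP[Rc _]]].
have [w xE] := leL_lact Lx; have [u cE] := leR_ract Rc.
rewrite /greenL leL_mul andbT.
have [||k kE] := @iter_mul_cancel (ract u) (fun s => lact w (y * s)) x.
- by move=> s; case: (u) => [u'|]; case: (w) => [w'|] //=; rewrite !mulgA.
- rewrite {2}xE cE; case: (u) => [u'|]; case: (w) => [w'|] //=;
  by rewrite !mulgA.
have gL s : leL T (lact w (y * s)) s.
  by case: (w) => [w'|] /=; rewrite ?mulgA leL_mul.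
rewrite -{1}kE; elim: k {kE} => [|k IHk] /=.
  by case: (w) => [w'|] /=; rewrite ?leL_mul ?leL_refl.
exact: leL_trans (gL _) IHk.
Qed.

Lemma Dclass_mull a x y : x \in Dclass a -> x * y \in Dclass a -> greenR T x (x * y).
Proof.
by rewrite !inE => ax axy; apply: stableR; rewrite greenD_sym in axy; apply: greenD_trans axy ax.
Qed.

Lemma Dclass_mulr a x y : x \in Dclass a -> y * x \in Dclass a -> greenL T x (y * x).
Proof.
by rewrite !inE => ax ayx; apply: stableL; rewrite greenD_sym in ayx; apply: greenD_trans ayx ax.
Qed.

Lemma Dclass_assocl a x y z :
  x \in Dclass a -> x * y * z \in Dclass a -> x * y \in Dclass a.
Proof.
move=> ax axyz; have := @Dclass_mull a x (y * z) ax; rewrite mulgA => /(_ axyz).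
case/andP=> xyz _; move: ax; rewrite !inE => /greenD_R; apply.
rewrite /greenR leR_mul andbT; exact: leR_trans xyz (leR_mul _ _).
Qed.

Lemma Dclass_assocr a x y z :
  z \in Dclass a -> x * (y * z) \in Dclass a -> y * z \in Dclass a.
Proof.
move=> az axyz; have := @Dclass_mulr a z (x * y) az; rewrite -mulgA => /(_ axyz).
case/andP=> xyz _; move: az; rewrite !inE => /greenD_L; apply.
rewrite /greenL leL_mul andbT; exact: leL_trans xyz (leL_mul _ _).
Qed.

End GreenTheory.

(* The adjoined zero is None. *)
Definition principal_factor (S : finSemigroupType) (a : S) : Type :=
  option {x | x \in Dclass a}.

HB.instance Definition _ (S : finSemigroupType) (a : S) :=
  Finite.on (principal_factor a).

Section PrincipalFactor.
Variables (S : finSemigroupType) (a : S).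
Local Notation P := (principal_factor a).
Implicit Types u v w : P.

(* insub t is t itself, as an element of the subtype, if t \in Dclass a,
   and None otherwise. *)
Definition pf_mul u v : P :=
  if u is Some x then if v is Some y then insub (val x * val y) else None
  else None.

Lemma val_pf_mulS x y : omap val (pf_mul (Some x) (Some y)) =
  if val x * val y \in Dclass a then Some (val x * val y) else None.
Proof. by rewrite /pf_mul; case: insubP => [t -> <-|/negbTE ->]. Qed.

Lemma omap_val_inj : injective (omap val : P -> option S).
Proof. by case=> [x|] [y|] //= [] /val_inj ->. Qed.

Lemma pf_mulA : associative pf_mul.
Proof.
case=> [x|] [y|] [z|] //=; last by case: insubP.
have [ax ay az] := And3 (valP x) (valP y) (valP z).
apply: omap_val_inj; case: (insubP _ (val y * val z)) => [yz Dyz yzE|nyz].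
  rewrite val_pf_mulS yzE mulgA; case: insubP => [xy Dxy xyE|nxy].
    by rewrite val_pf_mulS xyE.
  case: ifP => // xyz; case/negP: nxy; exact: Dclass_assocl xyz.
case: insubP => // xy Dxy xyE; rewrite val_pf_mulS xyE -mulgA.
case: ifP => // xyz; case/negP: nyz; exact: Dclass_assocr xyz.
Qed.

HB.instance Definition _ := isSemigroup.Build (principal_factor a) pf_mulA.

Lemma pf_mulE u v : u * v = pf_mul u v. Proof. by []. Qed.
Lemma pf_mul0u u : (None : P) * u = None. Proof. by []. Qed.
Lemma pf_mulu0 u : u * (None : P) = None. Proof. by case: u. Qed.

Lemma pf_stableR u v : u * v != None -> greenR [set: P] u (u * v).
Proof.
case: u v => [x|] [y|] // nz; have [ax ay] := (valP x, valP y).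
rewrite /greenR leR_mul andbT; apply/leRP.
rewrite pf_mulE in nz *; have := val_pf_mulS x y.
case E : (pf_mul (Some x) (Some y)) nz => [xy|] //= _; case: ifP => // Dxy [xyE].
have /andP[/leRP[xE|[t xE]] _] := Dclass_mull ax Dxy.
  by left; apply: omap_val_inj; rewrite /= xyE -xE.
have Dyt : val y * t \in Dclass a.
  have /andP[l1 l2] := Dclass_mulr ay Dxy.
  have L : greenL [set: S] (val x) (val y * t).
    by rewrite xE /greenL !leL_mulr.
  by move: ax; rewrite !inE => /greenD_L; apply.
have Dtyt : t * (val y * t) \in Dclass a.
  apply: (@Dclass_assocr _ _ (val x * val y)) => //.
  by rewrite mulgA -xE mulgA -xE.
right; exists (Some (exist (fun z => z \in Dclass a) _ Dtyt)); apply: omap_val_inj.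
rewrite pf_mulE val_pf_mulS /= xyE.
have -> : val x * val y * (t * (val y * t)) = val x.
  by rewrite [LHS]mulgA -xE mulgA -xE.
by rewrite ax.
Qed.

Lemma pf_stableL u v : v * u != None -> greenL [set: P] u (v * u).
Proof.
case: u v => [x|] [y|] // nz; have [ax ay] := (valP x, valP y).
rewrite /greenL leL_mul andbT; apply/leLP.
rewrite pf_mulE in nz *; have := val_pf_mulS y x.
case E : (pf_mul (Some y) (Some x)) nz => [yx|] //= _; case: ifP => // Dyx [yxE].
have /andP[/leLP[xE|[t xE]] _] := Dclass_mulr ax Dyx.
  by left; apply: omap_val_inj; rewrite /= yxE -xE.
have Dty : t * val y \in Dclass a.
  have /andP[r1 r2] := Dclass_mull ay Dyx.
  have R : greenR [set: S] (val x) (t * val y).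
    by rewrite xE /greenR !leR_mull.
  by move: ax; rewrite !inE => /greenD_R; apply.
have Dtyt : t * val y * t \in Dclass a.
  apply: (@Dclass_assocl _ _ _ _ (val y * val x)) => //.
  by rewrite -mulgA -xE -mulgA -xE.
right; exists (Some (exist (fun z => z \in Dclass a) _ Dtyt)); apply: omap_val_inj.
rewrite pf_mulE val_pf_mulS /= yxE.
have -> : t * val y * t * (val y * val x) = val x.
  by rewrite -[LHS]mulgA -xE -mulgA -xE.
by rewrite ax.
Qed.

Definition pf_H : rel P := greenH [set: P].

Lemma pf_H_equiv : equiv_class_of pf_H.
Proof.
by split; [exact: greenH_refl | exact: greenH_sym | exact: greenH_trans].
Qed.

Canonical pf_H_equivRel := EquivRelPack pf_H_equiv.

Lemma pf_H_mulr u v w : pf_H u v -> pf_H (u * w) (v * w).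
Proof.
case/andP=> /andP[uv vu] Ruv.
have L : greenL [set: P] (u * w) (v * w) by rewrite /greenL !leL_mulr.
rewrite /pf_H /greenH L /=; case/andP: L => Luv Lvu.
have null (s t : P) : leL [set: P] s t -> t = None -> s = None.
  by move=> /leLP[->//|[p ->]] ->; rewrite pf_mulu0.
case: (eqVneq (v * w) None) => [v0|nv].
  by rewrite (null _ _ Luv v0) v0 greenR_refl.
have nu : u * w != None by apply: contra_neq nv; apply: null.
have := pf_stableR nu; rewrite greenR_sym => /greenR_trans; apply.
exact: greenR_trans Ruv (pf_stableR nv).
Qed.

Lemma pf_H_mull u v w : pf_H u v -> pf_H (w * u) (w * v).
Proof.
case/andP=> Luv /andP[uv vu].
have R : greenR [set: P] (w * u) (w * v) by rewrite /greenR !leR_mull.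
rewrite /pf_H /greenH R andbT; case/andP: R => Ruv Rvu.
have null (s t : P) : leR [set: P] s t -> t = None -> s = None.
  by move=> /leRP[->//|[p ->]] ->.
case: (eqVneq (w * v) None) => [v0|nv].
  by rewrite (null _ _ Ruv v0) v0 greenL_refl.
have nu : w * u != None by apply: contra_neq nv; apply: null.
have := pf_stableL nu; rewrite greenL_sym => /greenL_trans; apply.
exact: greenL_trans Luv (pf_stableL nv).
Qed.

(* The quotient of the principal factor by its H-relation. *)
Definition principal_band : Type := {eq_quot pf_H}.

HB.instance Definition _ := EqQuotient.on principal_band.
HB.instance Definition _ := Choice.on principal_band.
HB.instance Definition _ :=
  Countable.copy principal_band (can_type (@reprK P principal_band)).
HB.instance Definition _ : isFinite principal_band := CanIsFinite (@reprK P principal_band).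

Definition Hclass (u : P) : principal_band := \pi_principal_band u.

Definition pfb_mul (x y : principal_band) : principal_band :=
  Hclass (generic_quotient.repr x * generic_quotient.repr y).

(* pfb_mul does not depend on representatives: H is a congruence here. *)
Lemma Hclass_mul u v : pfb_mul (Hclass u) (Hclass v) = Hclass (u * v).
Proof.
have H s : pf_H (generic_quotient.repr (Hclass s)) s.
  by apply/eqmodP; rewrite reprK.
apply/eqmodP.
exact: greenH_trans (pf_H_mulr _ (H u)) (pf_H_mull _ (H v)).
Qed.

Lemma pfb_mulA : associative pfb_mul.
Proof.
have K x : x = Hclass (generic_quotient.repr x) by rewrite /Hclass reprK.
move=> x y z; rewrite (K x) (K y) (K z) !Hclass_mul; congr Hclass.
exact: pf_mulA.
Qed.

HB.instance Definition _ := isSemigroup.Build principal_band pfb_mulA.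

Definition pfb_zero : principal_band := Hclass None.

Definition max_rect_subband (U : {set principal_band}) : bool :=
  maxset (fun V => rectangular_subband V && (pfb_zero \notin V)) U.

End PrincipalFactor.

(* Main.v *)
Require Import Defs.
From mathcomp Require Import all_boot all_order all_algebra all_fingroup.

(* In an E-solid semigroup the bipartite graph joining an R-class to an L-class
   of a D-class when they meet in a group is a disjoint union of complete
   bipartite graphs; let I_k and J_k be the R- and L-classes of the k-th
   component.  The groups of that component form a maximal rectangular subband
   modulo H.  An element a whose R-class lies in I_k and L-class in J_l has
   exactly one inverse in each H-class of I_l x J_k and no others, so that
   #|inverses a| = |I_l| |J_k|.  A permutation matching maps I_k x J_l into
   I_l x J_k and vice versa, which forces |I_k| |J_l| = |I_l| |J_k|
   (similarity), that is, #|inverses a| = #|inverses b| for b in [inverses a].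
   Conversely, under that equality an enumeration of the H-classes of each block
   pairs I_k x J_l with I_l x J_k involutively, and a is sent to its inverse in
   the paired H-class. *)

Set Implicit Arguments.
Unset Strict Implicit.
Unset Printing Implicit Defensive.

Local Open Scope group_scope.

(** * Inverses and Green's relations in a finite semigroup *)

Section Inverses.
Variable S : finSemigroupType.
Implicit Types a b c d e f g h x y : S.
Local Notation T := [set: S].
Local Notation L := (greenL T).
Local Notation R := (greenR T).
Local Notation H := (greenH T).

Lemma greenL_mulr c a b : L a b -> L (a * c) (b * c).
Proof. by case/andP=> ab ba; rewrite /greenL !leL_mulr. Qed.

Lemma greenR_mull c a b : R a b -> R (c * a) (c * b).
Proof. by case/andP=> ab ba; rewrite /greenR !leR_mull. Qed.

Lemma greenL_factor a u v : u * (v * a) = a -> L a (v * a).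
Proof. by move=> E; rewrite /greenL leL_mul -{1}E leL_mul. Qed.

Lemma greenR_factor a u v : a * v * u = a -> R a (a * v).
Proof. by move=> E; rewrite /greenR leR_mul -{1}E leR_mul. Qed.

Lemma idem_mulR e a : e \in idempotents S -> R e a -> e * a = a.
Proof.
by rewrite inE => /eqP ee /andP[_ /leRP[->|[x ->]]]; rewrite ?mulgA ee.
Qed.

Lemma idem_mulL e a : e \in idempotents S -> L e a -> a * e = a.
Proof.
by rewrite inE => /eqP ee /andP[_ /leLP[->|[x ->]]]; rewrite -?mulgA ee.
Qed.

Lemma idem_greenH_eq e f :
  e \in idempotents S -> f \in idempotents S -> L e f -> R e f -> e = f.
Proof.
move=> Ee Ef Lef Ref; rewrite -[RHS](idem_mulR Ee Ref).
by rewrite (idem_mulL Ef) // greenL_sym.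
Qed.

(* One direction of the Miller-Clifford theorem. *)
Lemma mul_idem_between p q k : k \in idempotents S -> L p k -> R k q ->
  R p (p * q) /\ L q (p * q).
Proof.
move=> Ek Lpk Rkq; have pk : p * k = p by apply: idem_mulL; rewrite 1?greenL_sym.
have kq := idem_mulR Ek Rkq; split.
- by rewrite -{1}pk greenR_mull.
- by rewrite -{1}kq greenL_mulr // greenL_sym.
Qed.

(** Unless [y] is itself idempotent, y = v y^2 = y^2 u gives v y = y u, and this common element is
    the idempotent. *)
Lemma idem_in_Hclass y : H y (y * y) -> exists2 e, e \in idempotents S & H y e.
Proof.
case/andP=> /andP[/leLP Ly _] /andP[/leRP Ry _].
case: Ly => [yy|[v vE]].
  by exists y; rewrite ?greenH_refl // inE -yy.
case: Ry => [yy|[u uE]].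
  by exists y; rewrite ?greenH_refl // inE -yy.
have vyu : v * y = y * u by rewrite {1}uE mulgA -vE.
have ey : y * u * y = y by rewrite -vyu -mulgA -vE.
exists (y * u); first by rewrite inE mulgA ey.
rewrite /greenH (greenR_factor ey) andbT -vyu (@greenL_factor _ y) //.
by rewrite vyu mulgA -uE.
Qed.

Lemma inverses_sym a b : (b \in inverses a) = (a \in inverses b).
Proof. by rewrite !inE andbC. Qed.

Section InverseFacts.
Variables a b : S.
Hypothesis ab : b \in inverses a.

Lemma inv_aba : a * b * a = a. Proof. by move: ab; rewrite inE => /andP[/eqP]. Qed.
Lemma inv_bab : b * a * b = b. Proof. by move: ab; rewrite inE => /andP[_ /eqP]. Qed.
Lemma inv_idem : a * b \in idempotents S. Proof. by rewrite inE mulgA inv_aba. Qed.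
Lemma inv_R : R a (a * b). Proof. exact: greenR_factor inv_aba. Qed.
Lemma inv_L : L b (a * b). Proof. by apply: (@greenL_factor _ b); rewrite mulgA inv_bab. Qed.

Lemma inv_mulR x : R a x -> a * b * x = x.
Proof.
by move=> Rax; rewrite (idem_mulR inv_idem) // (greenR_trans _ Rax) // greenR_sym inv_R.
Qed.

Lemma inv_mulL x : L b x -> x * (a * b) = x.
Proof.
by move=> Lbx; rewrite (idem_mulL inv_idem) // (greenL_trans _ Lbx) // greenL_sym inv_L.
Qed.

End InverseFacts.

Lemma inverse_uniq a b c : b \in inverses a -> c \in inverses a -> 
  a * b = a * c -> b * a = c * a -> b = c.
Proof.
by move=> /inv_bab bE /inv_bab cE abc bca; rewrite -bE -mulgA abc mulgA bca cE.
Qed.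

(** An arbitrary inverse [a'] is moved into the prescribed classes: the witness is [f * a' * e]. *)
Lemma inverse_ex a a' e f : a' \in inverses a ->
    e \in idempotents S -> f \in idempotents S -> R e a -> L f a ->
  exists b, [/\ b \in inverses a, a * b = e & b * a = f].
Proof.
move=> aa' Ee Ef Rea Lfa.
have ea := idem_mulR Ee Rea; have af := idem_mulL Ef Lfa.
have abE : a * (f * a' * e) = e.
  rewrite !mulgA af (idem_mulR (inv_idem aa')) //.
  by rewrite greenR_sym; apply: greenR_trans (inv_R aa').
have baE : f * a' * e * a = f.
  rewrite -mulgA ea -mulgA (idem_mulL _ (_ : L (a' * a) f)) //.
    by rewrite inv_idem // inverses_sym.
  by rewrite greenL_sym; apply: (greenL_trans Lfa); rewrite inv_L // inverses_sym.
exists (f * a' * e); split=> //.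
rewrite inE abE ea eqxx baE !mulgA /=.
by move: Ef; rewrite inE => /eqP ->; rewrite eqxx.
Qed.

Definition Ridem a := [set e in idempotents S | R e a].
Definition Lidem a := [set e in idempotents S | L e a].

(** An inverse [b] is determined by the pair [(a * b, b * a)], and [inverse_ex] realizes every pair
    of idempotents from the R-class and the L-class of [a]. *)
Lemma card_inverses a : inverses a != set0 ->
  #|inverses a| = (#|Ridem a| * #|Lidem a|)%N.
Proof.
case/set0Pn=> a' aa'; rewrite -cardsX.
have inj : {in inverses a &, injective (fun b => (a * b, b * a))}.
  by move=> b c ab ac [? ?]; apply: inverse_uniq ab ac _ _.
rewrite -(card_in_imset inj); apply: eq_card => -[e f].
apply/imsetP/idP => [[b ab [-> ->]]|].
  have ba : a \in inverses b by rewrite -inverses_sym.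
  have := inv_idem ab; have := inv_idem ba; rewrite !inE /= => -> ->.
  by rewrite greenR_sym inv_R // greenL_sym inv_L.
rewrite !inE /= => /andP[/andP[Ee Rea] /andP[Ef Lfa]].
have [||b [ab <- <-]] := inverse_ex aa' _ _ Rea Lfa; rewrite ?inE //.
by exists b.
Qed.

(** [a * b] and [a * c] are H-related idempotents, hence equal; likewise [b * a] and [c * a]. *)
Lemma inverses_greenH_eq a b c :
  b \in inverses a -> c \in inverses a -> H b c -> b = c.
Proof.
move=> ab ac /andP[Lbc Rbc].
have [ba ca] : a \in inverses b /\ a \in inverses c.
  by split; rewrite -inverses_sym.
apply: (inverse_uniq ab ac); apply: idem_greenH_eq; rewrite ?inv_idem //.
- by apply: greenL_trans (inv_L ac); apply: greenL_trans Lbc; rewrite greenL_sym inv_L.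
- by apply: greenR_trans (inv_R ac); rewrite greenR_sym inv_R.
- by apply: greenL_trans (inv_L ca); rewrite greenL_sym inv_L.
- by apply: greenR_trans (inv_R ca); apply: greenR_trans Rbc; rewrite greenR_sym inv_R.
Qed.

(** Together with [inv_mul_cancel], this makes x -> b x b a bijection between the H-classes of [a]
    and [b], with inverse y -> a y a. *)
Lemma greenH_inv_mul a b x : b \in inverses a -> H a x -> H b (b * x * b).
Proof.
move=> ab /andP[Lax Rax].
have ba : a \in inverses b by rewrite -inverses_sym.
have Lx : L b (x * b).
  apply: greenL_trans (inv_L ab) _; exact: greenL_mulr.
have Rx : R b (b * x).
  apply: greenR_trans (inv_R ba) _; exact: greenR_mull.
have abx := inv_mulR ab Rax; have xba := inv_mulL ba Lax.
rewrite /greenH (greenL_trans Lx) /=; last first.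
  by rewrite -mulgA (@greenL_factor _ a) // !mulgA abx.
by apply: (greenR_trans Rx); rewrite (@greenR_factor _ a) // -!mulgA xba.
Qed.

Lemma inv_mul_cancel a b x : b \in inverses a -> H a x ->
  a * (b * x * b) * a = x.
Proof.
move=> ab /andP[Lax Rax].
have ba : a \in inverses b by rewrite -inverses_sym.
by rewrite !mulgA (inv_mulR ab Rax) -mulgA (inv_mulL ba Lax).
Qed.

(** * Counting with H-classes *)

Definition Hset a := [set x | H a x].

Lemma in_Hset a x : (x \in Hset a) = H a x. Proof. by rewrite inE. Qed.

Lemma Hset_eq a b : H a b -> Hset a = Hset b.
Proof.
move=> ab; apply/setP=> x; rewrite !inE; apply/idP/idP; apply: greenH_trans => //.
by rewrite greenH_sym.
Qed.

Lemma HsetP a b : reflect (Hset a = Hset b) (H a b).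
Proof.
apply: (iffP idP) => [|E]; first exact: Hset_eq.
by rewrite -in_Hset E in_Hset greenH_refl.
Qed.

Lemma card_Hset_inverse a b : b \in inverses a -> #|Hset a| = #|Hset b|.
Proof.
have le c d : d \in inverses c -> #|Hset c| <= #|Hset d|.
  move=> cd; have inj : {in Hset c &, injective (fun x => d * x * d)}.
    move=> x y; rewrite !in_Hset => cx cy E.
    by rewrite -(inv_mul_cancel cd cx) E inv_mul_cancel.
  rewrite -(card_in_imset inj); apply/subset_leq_card/subsetP => _ /imsetP[x cx ->].
  by move: cx; rewrite !in_Hset => cx; apply: greenH_inv_mul cd cx.
by move=> ab; apply/eqP; rewrite eqn_leq !le // -inverses_sym.
Qed.

Definition inverse_Hunion b := [set y | [exists c in inverses b, H c y]].

(** The bijection sends [(c, x)] to [c * x * c] in the H-class of [c]; distinct inverses of [b] lie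
    in distinct H-classes. *)
Lemma card_inverse_Hunion b : #|inverse_Hunion b| = (#|inverses b| * #|Hset b|)%N.
Proof.
rewrite -cardsX.
have inj : {in setX (inverses b) (Hset b) &, injective (fun p => p.1 * p.2 * p.1)}.
  move=> [c x] [d y]; rewrite !in_setX !in_Hset /=.
  case/andP=> bc bx /andP[bd bdy] E.
  have cd : c = d.
    apply: (inverses_greenH_eq bc bd).
    have := greenH_inv_mul bd bdy; rewrite -E greenH_sym => Hd.
    by apply: greenH_trans Hd; apply: greenH_inv_mul bc bx.
  move: E; rewrite -cd => E; congr pair.
  by rewrite -(inv_mul_cancel bc bx) E inv_mul_cancel.
rewrite -(card_in_imset inj); apply: eq_card => y; rewrite inE.
apply/exists_inP/imsetP => [[c bc cy]|[[c x] /setXP[bc bx] ->]].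
  have cb : b \in inverses c by rewrite -inverses_sym.
  exists (c, b * y * b) => /=; last by rewrite inv_mul_cancel.
  by rewrite in_setX in_Hset bc; apply: greenH_inv_mul cb cy.
by exists c => //=; rewrite in_Hset in bx; apply: greenH_inv_mul bc bx.
Qed.

End Inverses.

(** * Matchings of an E-solid semigroup and numbers of inverses *)

Section Solid.
Variable S : finSemigroupType.
Hypothesis hS : E_solid S.
Implicit Types a b c d e f g h x y : S.
Local Notation T := [set: S].
Local Notation L := (greenL T).
Local Notation R := (greenR T).
Local Notation H := (greenH T).
Local Notation E := (idempotents S).

Lemma inverses_neq0 a : inverses a != set0. Proof. exact: hS.1. Qed.

(* E-solidity in terms of inverses: "contains inverses of" is, as a relation
   between H-classes, difunctional. *)
Lemma inverses_zigzag a b c d :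
  b \in inverses a -> c \in inverses b -> d \in inverses c ->
  exists2 d', d' \in inverses a & H d' d.
Proof.
move=> ab bc cd; have [ba cb dc] : [/\ a \in inverses b, b \in inverses c & c \in inverses d].
  by split; rewrite -inverses_sym.
(* The idempotents [h] and [k] given by E-solidity are to be [a * d'] and [d' * a]; they place [d']
   in the L-class and the R-class of [d]. *)
have [|||||h [Eh Rh Lh]] := hS.2 (a * b) (c * b) (c * d); rewrite ?inv_idem //.
- by apply: greenL_trans (inv_L cb); rewrite greenL_sym inv_L.
- by apply: greenR_trans (inv_R cd); rewrite greenR_sym inv_R.
have [|||||k [Ek Rk Lk]] := hS.2 (d * c) (b * c) (b * a); rewrite ?inv_idem //.
- by apply: greenL_trans (inv_L bc); rewrite greenL_sym inv_L.
- by apply: greenR_trans (inv_R ba); rewrite greenR_sym inv_R.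
have Rha : R h a by rewrite greenR_sym; apply: greenR_trans Rh; apply: inv_R.
have Lka : L k a by apply: greenL_trans Lk _; rewrite greenL_sym inv_L.
have [d' [ad' ahE dkE]] := inverse_ex ab Eh Ek Rha Lka.
exists d' => //; rewrite /greenH; apply/andP; split.
- apply: greenL_trans (inv_L ad') _; rewrite ahE; apply: greenL_trans Lh _.
  by rewrite greenL_sym inv_L.
- have d'a : a \in inverses d' by rewrite -inverses_sym.
  apply: greenR_trans (inv_R d'a) _; rewrite dkE greenR_sym.
  by apply: greenR_trans Rk; apply: inv_R.
Qed.

(** [b * a] and [a * b] lie in the R-class and the L-class of [b], hence of [c], so they prescribe
    an inverse [d] of [c]. *)
Lemma inverses_greenH a b c : b \in inverses a -> H b c ->
  exists2 d, d \in inverses c & H d a.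
Proof.
move=> ab bc; have ba : a \in inverses b by rewrite -inverses_sym.
have [x cx] := set0Pn _ (inverses_neq0 c).
case/andP: bc => Lbc Rbc.
have [||||d [cd abE baE]] := @inverse_ex _ c x (b * a) (a * b) cx; rewrite ?inv_idem //.
- by apply: greenR_trans Rbc; rewrite greenR_sym inv_R.
- by apply: greenL_trans Lbc; rewrite greenL_sym inv_L.
exists d => //; have dc : c \in inverses d by rewrite -inverses_sym.
rewrite /greenH (greenL_trans (inv_L cd)) ?abE 1?greenL_sym ?inv_L //=.
by rewrite (greenR_trans (inv_R dc)) // baE greenR_sym inv_R.
Qed.

(** The matching injects [inverse_Hunion d] into [inverse_Hunion c]; since the H-classes of [c] and
    [d] have equal size, that size cancels from the two cardinalities. *)
Lemma matching_card_inverses (f : {perm S}) a b :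
  permutation_matching f -> b \in inverses a -> #|inverses a| = #|inverses b|.
Proof.
move=> fM; suff le c d : d \in inverses c -> #|inverses d| <= #|inverses c|.
  by move=> ab; apply/eqP; rewrite eqn_leq !le // -inverses_sym.
move=> cd; have H0 : 0 < #|Hset c| by apply/card_gt0P; exists c; rewrite in_Hset greenH_refl.
rewrite -(leq_pmul2r H0) {1}(card_Hset_inverse cd) -!card_inverse_Hunion.
rewrite -(card_imset _ (@perm_inj _ f)); apply/subset_leq_card/subsetP.
move=> _ /imsetP[y dy ->]; move: dy; rewrite !inE => /exists_inP[z dz zy].
have [x yx xd] := inverses_greenH dz zy.
(* Up to H, the elements c, d, z, [f y] form a chain of successive inverses, which [inverses_zigzag]
   closes. *)
have [z' cz' z'y] : exists2 z', z' \in inverses c & H z' (f y).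
  have zd : d \in inverses z by rewrite -inverses_sym.
  have [u zu uf] : exists2 u, u \in inverses z & H u (f y).
    have fy : y \in inverses (f y) by rewrite -inverses_sym.
    have yz : H y z by rewrite greenH_sym.
    have [u zu uf] := inverses_greenH fy yz; by exists u.
  have [d' cd' d'u] := inverses_zigzag cd dz zu.
  by exists d' => //; apply: greenH_trans d'u uf.
by apply/exists_inP; exists z'.
Qed.

Definition inverse_Hclasses a := [set Hset b | b in inverses a].
(** For [a] in I_k x J_l, these are the H-classes of I_k x J_l, while [inverse_Hclasses a] consists
    of those of I_l x J_k. *)
Definition inverse2_Hclasses a := \bigcup_(b in inverses a) inverse_Hclasses b.

Lemma inverse2_HclassesE a b : b \in inverses a -> inverse2_Hclasses a = inverse_Hclasses b.
Proof.
move=> ab; apply/setP=> X; apply/bigcupP/idP => [[c ac /imsetP[d cd ->]]|Xb]; last by exists b.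
have ba : a \in inverses b by rewrite -inverses_sym.
have [d' bd' /HsetP <-] := inverses_zigzag ba ac cd.
exact: imset_f.
Qed.

Lemma card_inverse_Hclasses a : #|inverse_Hclasses a| = #|inverses a|.
Proof.
by apply: card_in_imset => b c ab ac /HsetP; apply: inverses_greenH_eq ab ac.
Qed.

Section Construction.
Hypothesis card_eq : forall a b, b \in inverses a -> #|inverses a| = #|inverses b|.

(* [Hset a] and its partner have the same position in the enumerations of
   [inverse2_Hclasses a] and [inverse_Hclasses a], which trade places
   when [a] is replaced by an inverse. *)
Definition dualH a :=
  nth (Hset a) (enum (inverse_Hclasses a))
    (index (Hset a) (enum (inverse2_Hclasses a))).

(** By [card_eq] the two enumerations have equal length, so the default value in [dualH] is never
    returned. *)
Lemma index_inverse2_Hclasses a :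
  index (Hset a) (enum (inverse2_Hclasses a)) < size (enum (inverse_Hclasses a)).
Proof.
have [b ab] := set0Pn _ (inverses_neq0 a).
rewrite -cardE card_inverse_Hclasses (card_eq ab) -card_inverse_Hclasses (inverse2_HclassesE ab).
rewrite cardE index_mem mem_enum.
by apply: imset_f; rewrite -inverses_sym.
Qed.

(** The class [dualH a] contains exactly one inverse of [a]; the default [a] only makes the function
    total. *)
Definition match_inv a := odflt a [pick b in inverses a | Hset b == dualH a].

Lemma match_invP a : match_inv a \in inverses a /\ Hset (match_inv a) = dualH a.
Proof.
rewrite /match_inv; case: pickP => [b /andP[ab /eqP] //|none].
have : dualH a \in inverse_Hclasses a by rewrite -mem_enum mem_nth // index_inverse2_Hclasses.
by case/imsetP=> b ab E'; have := none b; rewrite /= ab E' eqxx.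
Qed.

Lemma match_invK : involutive match_inv.
Proof.
move=> a; have [ab bE] := match_invP a; set b := match_inv a in ab bE *.
have [bc cE] := match_invP b; have ba : a \in inverses b by rewrite -inverses_sym.
apply: (inverses_greenH_eq bc ba); apply/HsetP; rewrite cE /dualH.
(* The two enumerations for [b] are those for [a] exchanged, so looking up [dualH a] recovers the
   index of [Hset a]. *)
rewrite (inverse2_HclassesE ba) -(inverse2_HclassesE ab) bE /dualH.
rewrite index_uniq ?enum_uniq ?index_inverse2_Hclasses //.
by rewrite nth_index // mem_enum (inverse2_HclassesE ab) imset_f.
Qed.

Lemma involution_of_card : exists f : {perm S}, involution_matching f.
Proof.
exists (perm (inv_inj match_invK)); split=> a; rewrite !permE; last exact: match_invK.
by have [] := match_invP a.
Qed.

End Construction.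
End Solid.

(** * Rectangular subbands and counting classes by transversals *)

Section RectangularBand.
Variable B : finSemigroupType.
Implicit Types (x y : B) (U : {set B}).

Lemma rectangular_subbandP U : reflect
    [/\ U != set0, {in U &, forall x y, x * y \in U}, {in U, forall x, x * x = x}
      & {in U &, forall x y, x * y * x = x}]
  (rectangular_subband U).
Proof.
apply: (iffP and3P) => [[/andP[U0 /forall_inP UM] /forall_inP UI /forall_inP UR]|[U0 UM UI UR]].
  split=> // [x y Ux Uy|x Ux|x y Ux Uy]; last by have /forall_inP/(_ y Uy)/eqP := UR x Ux.
    by have /forall_inP := UM x Ux; apply.
  exact/eqP/UI.
split; first rewrite /subsemigroup U0.
- by apply/forall_inP=> x Ux; apply/forall_inP=> y Uy; apply: UM.
- by apply/forall_inP=> x Ux; rewrite UI.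
- by apply/forall_inP=> x Ux; apply/forall_inP=> y Uy; rewrite UR.
Qed.

(** If y x = x, then [x] itself is the multiplier required in [U]; the relation thus becomes an
    equation free of [U]. *)
Lemma leR_idem U x y : x \in U -> x * x = x -> y * y = y ->
  leR U x y = (y * x == x).
Proof.
move=> Ux xx yy; apply/orP/eqP => [[/eqP->//|/exists_inP[z _ /eqP->]]|E].
  by rewrite mulgA yy.
by right; apply/exists_inP; exists x; rewrite ?E.
Qed.

Lemma leL_idem U x y : x \in U -> x * x = x -> y * y = y ->
  leL U x y = (x * y == x).
Proof.
move=> Ux xx yy; apply/orP/eqP => [[/eqP->//|/exists_inP[z _ /eqP->]]|E].
  by rewrite -mulgA yy.
by right; apply/exists_inP; exists x; rewrite ?E.
Qed.

Lemma card_equivalence_partition_transversal (r : rel B) (I : finType) (X : {set I})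
    (F : I -> B) (D : {set B}) :
  {in D & &, equivalence_rel r} -> {in X, forall i, F i \in D} ->
  {in X &, forall i j, r (F i) (F j) -> i = j} ->
  (forall x, x \in D -> exists2 i, i \in X & r (F i) x) ->
  #|equivalence_partition r D| = #|X|.
Proof.
move=> er XD inj sur; pose cl x := [set y in D | r x y].
have -> : equivalence_partition r D = [set cl (F i) | i in X].
  apply/setP=> A; apply/imsetP/imsetP => [[x Dx ->]|[i Xi ->]]; last by exists (F i); rewrite ?XD.
  have [i Xi ix] := sur x Dx; exists i => //; apply/setP=> y; rewrite !inE.
  by have [Dy|//] := boolP (y \in D); have [_ /(_ ix) ->] := er _ _ _ (XD i Xi) Dx Dy.
apply: card_in_imset => i j Xi Xj /setP/(_ (F j)); rewrite !inE XD //= => E.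
apply: inj => //; rewrite E; by have [] := er _ _ _ (XD j Xj) (XD j Xj) (XD j Xj).
Qed.

End RectangularBand.

(** * Maximal rectangular subbands of the principal band *)

Section PrincipalBand.
Variables (S : finSemigroupType) (a : S).
Hypothesis hS : E_solid S.
Implicit Types e f g h x y : S.
Local Notation T := [set: S].
Local Notation L := (greenL T).
Local Notation R := (greenR T).
Local Notation H := (greenH T).
Local Notation E := (idempotents S).
Local Notation D := (Dclass a).
Local Notation P := (principal_factor a).
Local Notation B := (principal_band a).
Local Notation zero := (pfb_zero a).

Lemma Dclass_L x y : x \in D -> L x y -> y \in D.
Proof. by rewrite !inE => /greenD_L; apply. Qed.

Lemma Dclass_R x y : x \in D -> R x y -> y \in D.
Proof. by rewrite !inE => /greenD_R; apply. Qed.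

Lemma insubD x (Dx : x \in D) : insub x = Some (exist (fun z => z \in D) x Dx) :> P.
Proof. exact: (@insubT S (fun z => z \in D)). Qed.

(** Total on [S]: elements outside the D-class go to zero, so products can be computed in [S]. *)
Definition cls x : B := Hclass (insub x : P).

Lemma HclassP (u v : P) : reflect (Hclass u = Hclass v) (pf_H u v).
Proof. by apply: (iffP idP) => [/eqmodP|/eqmodP]. Qed.

Lemma clsM x y : x \in D -> y \in D -> cls x * cls y = cls (x * y).
Proof.
move=> Dx Dy; rewrite [LHS]Hclass_mul; congr Hclass.
by rewrite (insubD Dx) (insubD Dy).
Qed.

Lemma cls_zero x : (cls x == zero) = (x \notin D).
Proof.
apply/eqP/idP => [/HclassP|nDx]; last by rewrite /cls insubN.
apply: contraL => Dx; rewrite (insubD Dx).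
apply/negP => /andP[/andP[/leLP[//|[u uE]] _] _].
by rewrite pf_mulu0 in uE.
Qed.

Lemma clsP (u : B) : u != zero -> exists2 x, x \in D & u = cls x.
Proof.
have -> : u = Hclass (generic_quotient.repr u) by rewrite /Hclass reprK.
case: (generic_quotient.repr u) => [[x Dx] _|]; last by rewrite eqxx.
by exists x => //; rewrite /cls (insubD Dx).
Qed.

(** Regularity makes H of the principal factor agree with H of [S]: if s L t and [z] is an inverse
    of [t], then s = (s z) t, and the multiplier s z is R-related to [s], so it stays in the
    D-class. The case of R is dual. *)
Lemma cls_eq x y : x \in D -> y \in D -> (cls x == cls y) = H x y.
Proof.
move=> Dx Dy; rewrite /cls (insubD Dx) (insubD Dy).
have val_leL (s t : {x | x \in D}) : leL [set: P] (Some s) (Some t) -> leL T (val s) (val t).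
  move=> /leLP[[->]|[[u|//]]]; first exact: leL_refl.
  move/(congr1 (omap val)); rewrite pf_mulE val_pf_mulS /=; case: ifP => // _ [->].
  exact: leL_mul.
have val_leR (s t : {x | x \in D}) : leR [set: P] (Some s) (Some t) -> leR T (val s) (val t).
  move=> /leRP[[->]|[[u|//]]]; first exact: leR_refl.
  move/(congr1 (omap val)); rewrite pf_mulE val_pf_mulS /=; case: ifP => // _ [->].
  exact: leR_mul.
have lift_leL (s t : {x | x \in D}) : L (val s) (val t) -> leL [set: P] (Some s) (Some t).
  move=> Lst; have [z tz] := set0Pn _ (inverses_neq0 hS (val t)).
  have sE : val s * (z * val t) = val s.
    apply: idem_mulL; rewrite ?inv_idem // 1?inverses_sym //.
    by rewrite greenL_sym; apply: greenL_trans Lst (inv_L _); rewrite -inverses_sym.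
  have Dsz : val s * z \in D.
    by apply: Dclass_R (valP s) _; apply: (@greenR_factor _ _ (val t)); rewrite -mulgA.
  apply/leLP; right; exists (Some (exist (fun z => z \in D) _ Dsz)); apply: omap_val_inj.
  by rewrite pf_mulE val_pf_mulS /= -mulgA sE (valP s).
have lift_leR (s t : {x | x \in D}) : R (val s) (val t) -> leR [set: P] (Some s) (Some t).
  move=> Rst; have [z tz] := set0Pn _ (inverses_neq0 hS (val t)).
  have sE : val t * z * val s = val s.
    apply: idem_mulR; rewrite ?inv_idem //.
    by rewrite greenR_sym; apply: greenR_trans Rst (inv_R _).
  have Dzs : z * val s \in D.
    by apply: Dclass_L (valP s) _; apply: (@greenL_factor _ _ (val t)); rewrite mulgA.
  apply/leRP; right; exists (Some (exist (fun z => z \in D) _ Dzs)); apply: omap_val_inj.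
  by rewrite pf_mulE val_pf_mulS /= mulgA sE (valP s).
apply/eqP/idP => [/HclassP/andP[/andP[l1 l2] /andP[r1 r2]]|Hxy].
  apply/andP; split; apply/andP; split.
  - exact: val_leL l1.
  - exact: val_leL l2.
  - exact: val_leR r1.
  - exact: val_leR r2.
apply/HclassP; case/andP: Hxy => Lxy Rxy.
by apply/andP; split; apply/andP; split;
   (apply: lift_leL || apply: lift_leR) => //=; rewrite 1?greenL_sym 1?greenR_sym.
Qed.

Lemma cls_idem x : x \in D -> cls x * cls x = cls x -> exists2 e, e \in E & H x e.
Proof.
move=> Dx; rewrite clsM // => xx.
have Dxx : x * x \in D by rewrite -[_ \in _]negbK -cls_zero xx cls_zero Dx.
by apply: idem_in_Hclass; rewrite greenH_sym -cls_eq // xx.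
Qed.

(* The block of [e] in the bipartite graph joining an R-class to an L-class when
   they meet in a group; by E-solidity its components are complete. *)
Definition block e := [set f in E | [exists g in E, R e g && L g f]].

Lemma blockP e f :
  reflect (f \in E /\ exists g, [/\ g \in E, R e g & L g f]) (f \in block e).
Proof.
rewrite [f \in block e]in_set; apply: (iffP andP) => -[Ef].
  by case/exists_inP=> g Eg /andP[eg gf]; split=> //; exists g.
by case=> g [Eg eg gf]; split=> //; apply/exists_inP; exists g; rewrite ?eg.
Qed.

Lemma block_sym e f : e \in E -> f \in block e -> e \in block f.
Proof.
move=> Ee /blockP[Ef [g [Eg eg gf]]]; apply/blockP; split=> //.
by apply: (hS.2 f g e); rewrite // 1?greenL_sym // greenR_sym.
Qed.

Lemma block_trans e f h : e \in E -> f \in block e -> h \in block f -> h \in block e.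
Proof.
move=> Ee /blockP[Ef [g [Eg eg gf]]] /blockP[Eh [k [Ek fk kh]]].
have [m [Em gm mk]] := hS.2 g f k Eg Ef Ek gf fk.
apply/blockP; split=> //; exists m; split=> //; first exact: greenR_trans eg gm.
exact: greenL_trans mk kh.
Qed.

(** This is completeness of the bipartite component: symmetry and transitivity put [h] in the block
    of [g]. *)
Lemma block_between e g h : e \in E -> g \in block e -> h \in block e ->
  exists k, [/\ k \in E, R g k & L k h].
Proof.
by move=> Ee ge he; have /blockP[] := block_trans (blockP _ _ ge).1 (block_sym Ee ge) he.
Qed.

Lemma block_Dclass e f : e \in D -> f \in block e -> f \in D.
Proof. by move=> De /blockP[_ [g [_ eg gf]]]; apply: Dclass_L (Dclass_R De eg) gf. Qed.

Lemma block_refl e : e \in E -> e \in block e.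
Proof. by move=> Ee; apply/blockP; split=> //; exists e; rewrite greenR_refl greenL_refl. Qed.

Definition band e : {set B} := [set cls f | f in block e].

(** * The rectangular band of a block *)

Section BandOfBlock.
Variable e : S.
Hypotheses (Ee : e \in E) (De : e \in D).

Lemma block_mul g h : g \in block e -> h \in block e -> R g (g * h) /\ L h (g * h).
Proof.
move=> ge he; have [k [Ek hk kg]] := block_between Ee he ge.
by apply: (mul_idem_between Ek); rewrite 1?greenL_sym 1?greenR_sym.
Qed.

Lemma block_idem g : g \in block e -> g * g = g.
Proof. by case/blockP; rewrite inE => /eqP. Qed.

Lemma cls_idemE g : g \in block e -> cls g * cls g = cls g.
Proof. by move=> ge; rewrite clsM ?(block_Dclass De) // block_idem. Qed.

Lemma band_rectangular : rectangular_subband (band e) && (zero \notin band e).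
Proof.
have eD := block_Dclass De.
apply/andP; split; last first.
  by apply/imsetP => -[g ge /esym/eqP]; rewrite cls_zero eD.
apply/rectangular_subbandP; split.
- by apply/set0Pn; exists (cls e); rewrite imset_f ?block_refl.
- move=> _ _ /imsetP[g ge ->] /imsetP[h he ->]; rewrite clsM ?eD //.
  (* The product g h is H-related to the idempotent [k] in the R-class of [g] and the L-class of
     [h]. *)
  have [Rg Lh] := block_mul ge he; have [k [Ek gk kh]] := block_between Ee ge he.
  have ke : k \in block e.
    apply: (block_trans Ee ge); apply/blockP; split=> //.
    by exists k; rewrite greenL_refl.
  apply/imsetP; exists k => //; apply/eqP.
  rewrite (cls_eq (Dclass_R (eD _ ge) Rg) (eD _ ke)).
  rewrite /greenH (greenR_trans _ gk) 1?greenR_sym // andbT.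
  by rewrite greenL_sym (greenL_trans kh).
- by move=> _ /imsetP[g ge ->]; apply: cls_idemE.
- move=> _ _ /imsetP[g ge ->] /imsetP[h he ->].
  have [Rg Lh] := block_mul ge he; have Dgh := Dclass_R (eD _ ge) Rg.
  rewrite (clsM (eD _ ge) (eD _ he)) (clsM Dgh (eD _ ge)).
  have [k [Ek gk kh]] := block_between Ee ge he.
  (* As [k] is L-related to g h and R-related to [g], Miller-Clifford puts g h g in the H-class of
     [g]. *)
  have [||R2 L2] := @mul_idem_between _ (g * h) g k Ek.
  + by rewrite greenL_sym; apply: greenL_trans kh Lh.
  + by rewrite greenR_sym.
  apply/eqP; rewrite (cls_eq (Dclass_R Dgh R2) (eD _ ge)).
  by rewrite greenH_sym /greenH L2 (greenR_trans Rg).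
Qed.

(** An element of [V] is the class of an idempotent [f]. Since e f gives a nonzero idempotent of
    [V], its H-class contains an idempotent [g] with e R g L f, which links [f] to [e]. *)
Lemma rectangular_sub_band (V : {set B}) : rectangular_subband V -> zero \notin V ->
  cls e \in V -> V \subset band e.
Proof.
case/rectangular_subbandP=> _ VM VI _ V0 Ve; apply/subsetP=> u Vu.
have [x Dx ux] := clsP (memPn V0 u Vu).
have [f Ef xf] : exists2 f, f \in E & H x f by apply: cls_idem; rewrite -?ux ?VI.
have Df : f \in D by case/andP: xf => /(Dclass_L Dx).
have uf : u = cls f by apply/eqP; rewrite ux cls_eq.
have Vef : cls e * cls f \in V by rewrite VM // -uf.
have := memPn V0 _ Vef; have := VI _ Vef.
rewrite clsM // cls_zero negbK => efI Def.
have [g Eg efg] := cls_idem Def efI; case/andP: efg => Lg Rg.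
rewrite uf; apply: imset_f; apply/blockP; split=> //; exists g; split=> //.
  exact: greenR_trans (Dclass_mull De Def) Rg.
by rewrite greenL_sym; apply: greenL_trans (Dclass_mulr Df Def) Lg.
Qed.

Lemma max_rect_subband_band : max_rect_subband (band e).
Proof.
apply/maxsetP; split=> [|V /andP[VR V0] sub]; first exact: band_rectangular.
apply/eqP; rewrite eqEsubset sub rectangular_sub_band //.
by apply: (subsetP sub); rewrite imset_f ?block_refl.
Qed.

(** The condition becomes h g H g. As h g is always L-related to [g] and R-related to [h], only g R
    h remains. *)
Lemma leR_band g h : g \in block e -> h \in block e ->
  leR (band e) (cls g) (cls h) = R g h.
Proof.
move=> ge he; have [Rhg Lhg] := block_mul he ge; have eD := block_Dclass De.
rewrite leR_idem ?imset_f ?cls_idemE // (clsM (eD _ he) (eD _ ge)).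
rewrite (cls_eq (Dclass_R (eD _ he) Rhg) (eD _ ge)).
rewrite /greenH greenL_sym Lhg /=; apply/idP/idP => [Rhgg|Rgh].
  by rewrite greenR_sym; apply: greenR_trans Rhgg.
by rewrite greenR_sym; apply: greenR_trans Rhg.
Qed.

Lemma leL_band g h : g \in block e -> h \in block e ->
  leL (band e) (cls g) (cls h) = L g h.
Proof.
move=> ge he; have [Rgh Lgh] := block_mul ge he; have eD := block_Dclass De.
rewrite leL_idem ?imset_f ?cls_idemE // (clsM (eD _ ge) (eD _ he)).
rewrite (cls_eq (Dclass_R (eD _ ge) Rgh) (eD _ ge)).
rewrite /greenH greenR_sym Rgh andbT; apply/idP/idP => [Lghg|Lgh'].
  by rewrite greenL_sym; apply: greenL_trans Lghg.
by rewrite greenL_sym; apply: greenL_trans Lgh.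
Qed.

Lemma greenR_band g h : g \in block e -> h \in block e ->
  greenR (band e) (cls g) (cls h) = R g h.
Proof. by move=> ge he; rewrite {1}/greenR !leR_band // greenR_sym andbb. Qed.

Lemma greenL_band g h : g \in block e -> h \in block e ->
  greenL (band e) (cls g) (cls h) = L g h.
Proof. by move=> ge he; rewrite {1}/greenL !leL_band // greenL_sym andbb. Qed.

(** Each R-class of the block meets the L-class of [e] in exactly one idempotent, so [Lidem e] is a
    transversal. *)
Lemma num_Rclasses_band : num_Rclasses (band e) = #|Lidem e|.
Proof.
have Lb g : g \in Lidem e -> g \in block e.
  rewrite inE => /andP[Eg ge]; apply/blockP; split=> //.
  by exists e; rewrite greenR_refl greenL_sym.
apply: (@card_equivalence_partition_transversal _ _ _ _ cls).
- move=> _ _ _ /imsetP[f fe ->] /imsetP[g ge ->] /imsetP[h he ->].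
  rewrite !greenR_band // greenR_refl; split=> // fg.
  by apply/idP/idP; apply: greenR_trans; rewrite // greenR_sym.
- by move=> g /Lb ge; rewrite imset_f.
- move=> g h gL hL; rewrite greenR_band ?Lb // => gh.
  move: gL hL; rewrite !inE => /andP[Eg ge] /andP[Eh he].
  apply: idem_greenH_eq; rewrite ?inE //.
  by apply: greenL_trans ge _; rewrite greenL_sym.
- move=> _ /imsetP[h he ->].
  have /blockP[_ [g [Eg hg ge]]] := block_sym Ee he.
  have gL : g \in Lidem e by rewrite inE Eg.
  by exists g => //; rewrite (greenR_band (Lb _ gL) he) greenR_sym.
Qed.

Lemma num_Lclasses_band : num_Lclasses (band e) = #|Ridem e|.
Proof.
have Rb g : g \in Ridem e -> g \in block e.
  rewrite inE => /andP[Eg ge]; apply/blockP; split=> //.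
  by exists g; rewrite greenL_refl greenR_sym.
apply: (@card_equivalence_partition_transversal _ _ _ _ cls).
- move=> _ _ _ /imsetP[f fe ->] /imsetP[g ge ->] /imsetP[h he ->].
  rewrite !greenL_band // greenL_refl; split=> // fg.
  by apply/idP/idP; apply: greenL_trans; rewrite // greenL_sym.
- by move=> g /Rb ge; rewrite imset_f.
- move=> g h gR hR; rewrite greenL_band ?Rb // => gh.
  move: gR hR; rewrite !inE => /andP[Eg ge] /andP[Eh he].
  apply: idem_greenH_eq; rewrite ?inE //.
  by apply: greenR_trans ge _; rewrite greenR_sym.
- move=> _ /imsetP[h /blockP[Eh [g [Eg eg gh]]] ->].
  have gR : g \in Ridem e by rewrite inE Eg greenR_sym.
  have he : h \in block e by apply/blockP; split=> //; exists g.
  by exists g => //; rewrite (greenL_band (Rb _ gR) he).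
Qed.

End BandOfBlock.

(** Any element of [U] is the class of some idempotent [e]; then [U] lies in [band e], and
    maximality gives equality. *)
Lemma max_rect_subbandE (U : {set B}) : max_rect_subband U ->
  exists e, [/\ e \in E, e \in D & U = band e].
Proof.
case/maxsetP=> /andP[UR U0] Umax; have /rectangular_subbandP[/set0Pn[u Uu] _ UI _] := UR.
have [x Dx ux] := clsP (memPn U0 u Uu).
have [e Ee xe] : exists2 e, e \in E & H x e by apply: cls_idem; rewrite -?ux ?UI.
have De : e \in D by case/andP: xe => /(Dclass_L Dx).
exists e; split=> //; apply/esym/Umax; first exact: band_rectangular.
by apply: rectangular_sub_band; rewrite // -(_ : u = cls e) //; apply/eqP; rewrite ux cls_eq.
Qed.

Lemma similar_bandsE e f : e \in E -> e \in D -> f \in E -> f \in D ->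
  similar_bands (band e) (band f) <->
  (#|Lidem e| * #|Ridem f| = #|Lidem f| * #|Ridem e|)%N.
Proof.
move=> Ee De Ef Df; rewrite /similar_bands !num_Rclasses_band // !num_Lclasses_band //.
have nz h : h \in E -> ((#|Ridem h|)%:R != 0 :> rat)%R.
  move=> Eh; rewrite Num.Theory.pnatr_eq0 -lt0n; apply/card_gt0P; exists h.
  by rewrite inE Eh greenR_refl.
split=> [/eqP|Eq].
  by rewrite GRing.eqr_div ?nz // -!GRing.natrM Num.Theory.eqr_nat => /eqP.
by apply/eqP; rewrite GRing.eqr_div ?nz // -!GRing.natrM Num.Theory.eqr_nat Eq.
Qed.

End PrincipalBand.

(** * Similarity of bands as equality of numbers of inverses *)

Section Similarity.
Variable S : finSemigroupType.
Hypothesis hS : E_solid S.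
Implicit Types a b e f : S.

Lemma card_inverses_idem a b : b \in inverses a ->
  #|inverses a| = (#|Ridem (a * b)%g| * #|Lidem (b * a)%g|)%N.
Proof.
move=> ab; have ba : a \in inverses b by rewrite -inverses_sym.
have Ra := inv_R ab; have La := inv_L ba.
rewrite card_inverses ?inverses_neq0 //.
congr (_ * _)%N; apply: eq_card => e; rewrite !inE; congr (_ && _).
  by apply/idP/idP => /greenR_trans; apply; rewrite // greenR_sym.
by apply/idP/idP => /greenL_trans; apply; rewrite // greenL_sym.
Qed.

Lemma matching_similar (p : {perm S}) : permutation_matching p ->
  forall (a : S) (U1 U2 : {set principal_band a}),
    max_rect_subband U1 -> max_rect_subband U2 -> similar_bands U1 U2.
Proof.
move=> pM a U1 U2 /(max_rect_subbandE hS)[e [Ee De ->]] /(max_rect_subbandE hS)[f [Ef Df ->]].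
apply/(similar_bandsE hS) => //.
(* Choose [c] with e L c R f and its inverse [b] with c b = f and b c = e: the numbers of inverses
   of [c] and [b] are then the two cross products to be compared. *)
have /exists_inP[c _ /andP[ec cf]] : greenD [set: S] e f.
  by move: De Df; rewrite !inE greenD_sym; apply: greenD_trans.
have [c' cc'] := set0Pn _ (inverses_neq0 hS c).
rewrite greenR_sym in cf.
have [b [cb cbE bcE]] := inverse_ex cc' Ef Ee cf ec.
have bc : c \in inverses b by rewrite -inverses_sym.
have := matching_card_inverses hS pM cb.
by rewrite (card_inverses_idem cb) (card_inverses_idem bc) cbE bcE mulnC => ->; rewrite mulnC.
Qed.

Lemma similar_card_inverses :
  (forall (a : S) (U1 U2 : {set principal_band a}),
     max_rect_subband U1 -> max_rect_subband U2 -> similar_bands U1 U2) ->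
  forall a b, b \in inverses a -> #|inverses a| = #|inverses b|.
Proof.
move=> sim a b ab; have ba : a \in inverses b by rewrite -inverses_sym.
have Da : a \in Dclass a by rewrite inE greenD_refl.
have De : a * b \in Dclass a := Dclass_R Da (inv_R ab).
have Df : b * a \in Dclass a by apply: Dclass_L Da _; rewrite inv_L.
have Ee := inv_idem ab; have Ef := inv_idem ba.
have /(similar_bandsE hS Ee De Ef Df) eq_ratio := sim a _ _
  (max_rect_subband_band hS Ee De) (max_rect_subband_band hS Ef Df).
by rewrite (card_inverses_idem ab) (card_inverses_idem ba) mulnC -eq_ratio mulnC.
Qed.

End Similarity.

Theorem theorem1p3p5 (S : finSemigroupType) (hS : E_solid S) :
  ((exists f : {perm S}, permutation_matching f) <->
     (forall (a : S) (U1 U2 : {set principal_band a}),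
        max_rect_subband U1 -> max_rect_subband U2 -> similar_bands U1 U2))
  /\ ((exists f : {perm S}, permutation_matching f) ->
        exists f : {perm S}, involution_matching f).
Proof.
split; first split.
- by case=> f fM; apply: (matching_similar hS fM).
- move/(similar_card_inverses hS)/(involution_of_card hS) => [f [fM _]].
  by exists f.
- case=> f fM; apply: (involution_of_card hS) => a b.
  exact: (matching_card_inverses hS fM).
Qed.
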